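(* Let $l,m,n$ be nonnegative integers. Then $$\sum_{k=0}^l(-1)^{m-k}\binom{l}{k}\binom{m-k}{n}\binom{2k}{k-2l+m} =\sum_{k=0}^l\binom lk\binom{2k}n\binom{n-l}{m+n-3k-l}.$$
   Context: For any (real or complex) number $x$ and integer $k$, the binomial coefficient is defined by $\binom xk=\frac1{k!}\prod_{j=0}^{k-1}(x-j)$ if $k>0$, $\binom x0=1$, and $\binom xk=0$ if $k<0$. In particular the upper argument may be negative (e.g. $n-l<0$). *)

(* Defs.v *)
From HB Require Import structures.
From mathcomp Require Import all_boot all_order all_algebra.

Set Implicit Arguments.
Unset Strict Implicit.
Unset Printing Implicit Defensive.

Import Order.TTheory GRing.Theory Num.Theory.
Local Open Scope ring_scope.

(* Generalized binomial coefficient; for k = 0 the empty product gives 1, and *)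
(* Negz covers exactly the integers k < 0.                                    *)
Definition gbinom (F : numFieldType) (x : F) (k : int) : F :=
  match k with
  | Posz n => (n`!)%:R^-1 * \prod_(0 <= j < n) (x - j%:R)
  | Negz _ => 0
  end.

(* Main.v *)
Require Import Defs.
From HB Require Import structures.
From mathcomp Require Import all_boot all_order all_algebra.
From mathcomp Require Import zify ring.

Set Implicit Arguments.
Unset Strict Implicit.
Unset Printing Implicit Defensive.

Import Order.TTheory GRing.Theory Num.Theory.
Local Open Scope ring_scope.

(** Put [z = 1 + y].  Both sides are the coefficient of [x^m y^n] in [G^l],
    where [G = x^2 z^2 + x (1 - x z)^2].  Expanding this binomial gives the
    left-hand side; expanding [(1 + x) G = x + x^2 (x + (1 + x) y)^2] and then
    dividing by [(1 + x)^l] gives the right-hand side, the upper argument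
    [n - l] being the exponent of [1 + x] that remains with [y^n]. *)

Section GeneralizedBinomial.

Lemma natr_ffact (R : pzRingType) (a k : nat) :
  (a ^_ k)%:R = \prod_(0 <= j < k) (a%:R - j%:R) :> R.
Proof.
elim: k => [|k IHk]; first by rewrite big_geq.
rewrite big_nat_recr //= -IHk ffactnSr natrM.
have [le_ka|lt_ak] := leqP k a; first by rewrite natrB.
by rewrite ffact_small // !mul0r.
Qed.

Variable F : numFieldType.
Implicit Types (x : F) (k : int).

Lemma gbinom_nat (a j : nat) : gbinom (a%:R : F) j%:Z = 'C(a, j)%:R.
Proof.
have fact_neq0 : (j`!)%:R != 0 :> F by rewrite pnatr_eq0 -lt0n fact_gt0.
by rewrite /= -natr_ffact -bin_ffact natrM mulrC mulfK.
Qed.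

Lemma gbinom_neg x k : k < 0 -> gbinom x k = 0.
Proof. by case: k. Qed.

Lemma gbinom0 x : gbinom x 0 = 1.
Proof. by rewrite /= big_geq // mulr1 invr1. Qed.

Lemma gbinom_pascal x k : gbinom (x + 1) k = gbinom x k + gbinom x (k - 1).
Proof.
case: k => [[|k]|k]; [by rewrite !gbinom0 addr0 | | by rewrite /= addr0].
have -> : k.+1%:Z - 1 = k%:Z by lia.
rewrite /= big_nat_recl // big_nat_recr //= subr0.
under eq_bigr => j _ do rewrite -natr1 opprD addrACA subrr addr0.
have fact_neq0 : (k`!)%:R != 0 :> F by rewrite pnatr_eq0 -lt0n fact_gt0.
have k1_neq0 : k%:R + 1 != 0 :> F by rewrite natr1 pnatr_eq0.
rewrite factS natrM -natr1.
by field; rewrite fact_neq0.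
Qed.

End GeneralizedBinomial.

Section BinomialPolynomial.

Variable R : comNzRingType.

Lemma coef_linear_exp (a b : R) (N i : nat) :
  ((a%:P + b *: 'X) ^+ N)`_i = a ^+ (N - i) * b ^+ i *+ 'C(N, i).
Proof.
have -> : (a%:P + b *: 'X) ^+ N
    = \poly_(j < N.+1) (a ^+ (N - j) * b ^+ j *+ 'C(N, j)).
  rewrite exprDn poly_def; apply: eq_bigr => j _.
  by rewrite exprZn -polyC_exp mul_polyC scalerA scalerMnl.
by rewrite coef_poly ltnS; case: leqP => // lt_Ni; rewrite bin_small.
Qed.

Lemma coef_XD1_exp (N i : nat) :
  (('X + 1 : {poly R}) ^+ N)`_i = 'C(N, i)%:R.
Proof.
by rewrite addrC -[X in _ + X]scale1r coef_linear_exp !expr1n mulr1.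
Qed.

End BinomialPolynomial.

Section BinomialSeries.

Variable F : numFieldType.
Implicit Types (P A : {poly F}) (x : F).

(* The coefficient of ['X^m] in the power series [P * (1 + 'X)^x]. *)
Definition coef_mul_binom P x (m : nat) : F :=
  \sum_(i < m.+1) P`_i * gbinom x (m%:Z - i%:Z).

Lemma coef_mul_binom_nat P (a m : nat) :
  coef_mul_binom P a%:R m = (P * ('X + 1) ^+ a)`_m.
Proof.
rewrite coefM; apply: eq_bigr => i _.
by rewrite subzn ?gbinom_nat ?coef_XD1_exp // -ltnS.
Qed.

Lemma coef_mul_binom0 P x : coef_mul_binom P x 0 = P`_0.
Proof. by rewrite /coef_mul_binom big_ord1 gbinom0 mulr1. Qed.

Lemma coef_mul_binom_pascal P x (m : nat) :
  coef_mul_binom P (x + 1) m.+1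
    = coef_mul_binom P x m.+1 + coef_mul_binom P x m.
Proof.
rewrite /coef_mul_binom.
under eq_bigr => i _ do rewrite gbinom_pascal mulrDr.
rewrite big_split; congr (_ + _); rewrite big_ord_recr /= gbinom_neg; last lia.
rewrite mulr0 addr0; apply: eq_bigr => i _; congr (_ * gbinom _ _); lia.
Qed.

Lemma coef_mul_binom_sumXn (I : finType) (c : I -> F) (e : I -> nat) x m :
  coef_mul_binom (\sum_i c i *: 'X^(e i)) x m
    = \sum_i c i * gbinom x (m%:Z - (e i)%:Z).
Proof.
rewrite /coef_mul_binom.
under eq_bigr => j _ do rewrite coef_sum mulr_suml.
rewrite exchange_big; apply: eq_bigr => i _ /=.
under eq_bigr => j _ do rewrite coefZ coefXn -mulrA mulr_natl mulrb.
rewrite -mulr_sumr -big_mkcond; congr (_ * _).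
have [lt_em1|le_m1e] := ltnP (e i) m.+1.
  by rewrite (big_pred1 (Ordinal lt_em1)).
rewrite gbinom_neg; last lia.
by apply: big_pred0 => j; apply/ltn_eqF/(leq_trans (ltn_ord j)).
Qed.

Lemma coef_XD1_cancel A P x :
    (forall m, (('X + 1) * A)`_m = coef_mul_binom P (x + 1) m) ->
  forall m, A`_m = coef_mul_binom P x m.
Proof.
move=> coefXD1A; elim=> [|m IHm].
  have := coefXD1A 0; rewrite !coef_mul_binom0.
  by rewrite mulrDl mul1r coefD coefXM add0r.
have := coefXD1A m.+1; rewrite coef_mul_binom_pascal.
by rewrite mulrDl mul1r coefD coefXM /= IHm addrC => /addIr.
Qed.

Lemma coef_XD1_exp_quotient A P (l n : nat) :
    ('X + 1) ^+ l * A = P * ('X + 1) ^+ n ->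
  forall m, A`_m = coef_mul_binom P (n%:R - l%:R) m.
Proof.
elim: l A => [|l IHl] A.
  by rewrite mul1r subr0 => -> m; rewrite coef_mul_binom_nat.
rewrite exprSr -mulrA => /IHl coefXD1A; apply: coef_XD1_cancel => m.
by rewrite coefXD1A -natr1 opprD addrA subrK.
Qed.

End BinomialSeries.

Section GeneratingPolynomial.

Variable R : comNzRingType.

(* The outer variable is [x], the inner one is [y]. *)
Definition genpoly : {poly {poly R}} :=
  let z := 'X + 1 : {poly R} in (z *: 'X) ^+ 2 + 'X * (1 - z *: 'X) ^+ 2.

Lemma coef_genpoly_exp (l m : nat) :
  (genpoly ^+ l)`_m = \sum_(k < l.+1 | (2 * l <= m + k)%N)
    ('C(l, k)%:R * (-1) ^+ (m - k) * 'C(2 * k, m + k - 2 * l)%:R)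
      *: ('X + 1) ^+ (m - k).
Proof.
rewrite /genpoly exprDn coef_sum [RHS]big_mkcond /=; apply: eq_bigr => k _.
have le_kl : (k <= l)%N by rewrite -ltnS.
set z := 'X + 1.
have termE : ((z *: 'X) ^+ 2) ^+ (l - k) * ('X * (1 - z *: 'X) ^+ 2) ^+ k
    = z ^+ (2 * (l - k))
        *: ('X^(2 * l - k) * (1%:P + (- z) *: 'X) ^+ (2 * k)).
  rewrite -exprM exprMn -exprM exprZn -scalerAl mulrA -exprD scaleNr.
  by congr (_ *: ('X^_ * _)); lia.
rewrite termE coefMn coefZ coefXnM.
case: ltnP => [lt_m|le_m]; first by rewrite ifF ?mulr0 ?mul0rn //; lia.
rewrite ifT; last lia.
have -> : (m - (2 * l - k) = m + k - 2 * l)%N by lia.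
have -> : (m - k = 2 * (l - k) + (m + k - 2 * l))%N by lia.
rewrite coef_linear_exp expr1n mul1r -[- z]mulN1r exprMn.
have signr_even_add (i j : nat) : (-1) ^+ (2 * i + j) = (-1) ^+ j :> R.
  by rewrite exprD exprM sqrrN !expr1n mul1r.
rewrite signr_even_add exprD.
by rewrite -mul_polyC !polyCM !polyC_exp polyCN !polyC_natr; ring.
Qed.

Lemma XD1_mul_swapXY_genpoly :
  ('X + 1)%:P * swapXY genpoly
    = 'X%:P + 'X%:P ^+ 2 * ('X%:P + ('X + 1) *: 'X) ^+ 2.
Proof.
rewrite /genpoly -!mul_polyC !polyCD polyC1.
by rewrite !(rmorphD, rmorphN, rmorphM, rmorph1) /= swapXY_X swapXY_Y; ring.
Qed.

(* The subtraction [3 * k + l - n] truncates only when [2 * k < n], where the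
   coefficient ['C(2 * k, n)] vanishes. *)
Lemma XD1_exp_mul_coef_genpoly_exp (l n : nat) :
  ('X + 1) ^+ l * (swapXY (genpoly ^+ l))`_n =
  (\sum_(k < l.+1) ('C(l, k)%:R * 'C(2 * k, n)%:R) *: 'X^(3 * k + l - n))
    * ('X + 1) ^+ n.
Proof.
rewrite -coefCM polyC_exp rmorphXn -exprMn /= XD1_mul_swapXY_genpoly.
rewrite exprDn coef_sum mulr_suml; apply: eq_bigr => k _.
rewrite coefMn -scalerA -scalerAl scaler_nat; congr (_ *+ _).
rewrite -scalerAl scaler_nat exprMn -!exprM mulrA -exprD.
rewrite -polyC_exp coefCM coef_linear_exp.
have [lt_kn|le_nk] := ltnP (2 * k) n; first by rewrite bin_small ?mulr0.
rewrite mulrnAr mulrA -exprD; congr ('X^_ * _ *+ _).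
by have := ltn_ord k; lia.
Qed.

End GeneratingPolynomial.

Section GeneralizedBinomialExpansions.

Variables (F : numFieldType) (l m n : nat).

Lemma coef_genpoly_exp_gbinom :
  (genpoly F ^+ l)`_m`_n = \sum_(k < l.+1)
    (-1) ^ (m%:Z - k%:Z) * gbinom (l%:R : F) k%:Z
      * gbinom (m%:R - k%:R : F) n%:Z
      * gbinom ((2 * k)%:R : F) (k%:Z - 2 * l%:Z + m%:Z).
Proof.
rewrite coef_genpoly_exp coef_sum big_mkcond; apply: eq_bigr => k _.
have le_kl : (k <= l)%N by rewrite -ltnS.
have [le_2l|lt_2l] := leqP (2 * l) (m + k); last first.
  by rewrite [gbinom (2 * k)%:R _]gbinom_neg ?mulr0 //; lia.
have -> : k%:Z - 2 * l%:Z + m%:Z = (m + k - 2 * l)%N%:Z by lia.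
have le_km : (k <= m)%N by lia.
by rewrite coefZ coef_XD1_exp -natrB // subzn // -exprnP !gbinom_nat; ring.
Qed.

Lemma coef_genpoly_exp_gbinom_quotient :
  (genpoly F ^+ l)`_m`_n = \sum_(k < l.+1)
    gbinom (l%:R : F) k%:Z * gbinom ((2 * k)%:R : F) n%:Z
      * gbinom (n%:R - l%:R : F) (m%:Z + n%:Z - 3 * k%:Z - l%:Z).
Proof.
rewrite -coef_swapXY.
rewrite (coef_XD1_exp_quotient (XD1_exp_mul_coef_genpoly_exp F l n)).
rewrite coef_mul_binom_sumXn; apply: eq_bigr => k _; rewrite !gbinom_nat.
have [lt_kn|le_nk] := ltnP (2 * k) n.
  by rewrite (bin_small lt_kn) mulr0 !mul0r.
by congr (_ * gbinom _ _); have := ltn_ord k; lia.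
Qed.

End GeneralizedBinomialExpansions.

Theorem theorem1p1 (F : numFieldType) (l m n : nat) :
  \sum_(0 <= k < l.+1)
     (-1) ^ (m%:Z - k%:Z) * gbinom (l%:R : F) k%:Z
       * gbinom (m%:R - k%:R : F) n%:Z
       * gbinom ((2 * k)%:R : F) (k%:Z - 2 * l%:Z + m%:Z)
  = \sum_(0 <= k < l.+1)
     gbinom (l%:R : F) k%:Z * gbinom ((2 * k)%:R : F) n%:Z
       * gbinom (n%:R - l%:R : F) (m%:Z + n%:Z - 3 * k%:Z - l%:Z).
Proof.
rewrite !big_mkord -coef_genpoly_exp_gbinom.
exact: coef_genpoly_exp_gbinom_quotient.
Qed.
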